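(* Let $f:\mathbb{R}^n\to\mathbb{R}$ be a polynomial function of degree $d\geq 1$. Then for any compact semialgebraic subset $A$ of $\mathbb{R}^n$ there exists $C=C(f,A)>0$ such that for every $C^1$ function $g:\mathbb{R}^n\to\mathbb{R}$ with compact support contained in $A$, \[\left|\int_A e^{i\lambda f(x)} g(x)\,dx\right|\leq C\lambda^{-\frac1d}\big(\|g\|_\infty+\|\nabla g\|_1\big)\quad\text{for all }\lambda>0.\]
   Context: For a $C^1$ function $g$ with compact support, $\|g\|_\infty=\sup_{\mathbb{R}^n}|g|$ and $\|\nabla g\|_1=\int_{\mathbb{R}^n}\|\nabla g(x)\|\,dx$, where $\|\cdot\|$ is the Euclidean norm. *)

(* Defs.v *)
From HB Require Import structures.
From mathcomp Require Import all_boot all_order all_algebra.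
From mathcomp Require Import all_classical all_reals all_analysis.
From mathcomp Require mpoly.
From Stdlib Require List.

Set Implicit Arguments.
Unset Strict Implicit.
Unset Printing Implicit Defensive.
Import Order.TTheory GRing.Theory Num.Theory.
Import numFieldNormedType.Exports.
Local Open Scope classical_set_scope.
Local Open Scope ring_scope.

Section Defs.
Variable R : realType.

Definition peval (n : nat) (p : mpoly.mpoly n R) (x : 'rV[R]_n) : R :=
  mpoly.meval (fun i => x 0 i) p.

(* total degree of a polynomial : max total degree of monomials in the support (0 for p = 0) *)
Definition pdeg (n : nat) (p : mpoly.mpoly n R) : nat :=
  \max_(m <- mpoly.msupp p) mpoly.mdeg m.

Definition basic_semialg (n : nat) (p : mpoly.mpoly n R)
    (qs : seq (mpoly.mpoly n R)) : set 'rV[R]_n :=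
  [set x | peval p x = 0 /\ (forall q, List.In q qs -> 0 < peval q x)].

Definition semialgebraic (n : nat) (A : set 'rV[R]_n) : Prop :=
  exists s : seq (mpoly.mpoly n R * seq (mpoly.mpoly n R)),
    A = [set x | exists2 pq, List.In pq s & basic_semialg pq.1 pq.2 x].

(* Lebesgue integral over R^n, computed as the iterated integral over the
   coordinates (first coordinate outermost). *)
Fixpoint integral_Rn (n : nat) : ('rV[R]_n -> R) -> R :=
  match n return ('rV[R]_n -> R) -> R with
  | 0 => fun F => F 0
  | n'.+1 => fun F =>
      Rintegral (@lebesgue_measure R) setT
        (fun t : R => integral_Rn
           (fun v : 'rV[R]_n' =>
              F (\row_(i < n'.+1) match unlift ord0 i with
                                  | None => t
                                  | Some j => v 0 j end)))
  end.

Definition evec (n : nat) (i : 'I_n) : 'rV[R]_n := delta_mx 0 i.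

Definition partial (n : nat) (i : 'I_n) (g : 'rV[R]_n -> R) (x : 'rV[R]_n) : R :=
  'D_(evec i) g x.

Definition C1 (n : nat) (g : 'rV[R]_n -> R) : Prop :=
  (forall x, differentiable g x) /\ (forall i, continuous (partial i g)).

Definition grad_norm (n : nat) (g : 'rV[R]_n -> R) (x : 'rV[R]_n) : R :=
  Num.sqrt (\sum_(i < n) (partial i g x) ^+ 2).

Definition support_fn (n : nat) (g : 'rV[R]_n -> R) : set 'rV[R]_n :=
  closure [set x | g x != 0].

Definition sup_norm (n : nat) (g : 'rV[R]_n -> R) : R :=
  sup [set `|g x| | x in [set: 'rV[R]_n]].

Definition grad_L1 (n : nat) (g : 'rV[R]_n -> R) : R :=
  integral_Rn (grad_norm g).

Definition restr (n : nat) (A : set 'rV[R]_n) (h : 'rV[R]_n -> R) (x : 'rV[R]_n) : R :=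
  if `[< A x >] then h x else 0.

(* |\int_A e^{i lam f(x)} g(x) dx|, with e^{i t} = cos t + i sin t *)
Definition osc_integral_abs (n : nat) (f : mpoly.mpoly n R) (A : set 'rV[R]_n)
    (g : 'rV[R]_n -> R) (lam : R) : R :=
  let re := integral_Rn (restr A (fun x => cos (lam * peval f x) * g x)) in
  let im := integral_Rn (restr A (fun x => sin (lam * peval f x) * g x)) in
  Num.sqrt (re ^+ 2 + im ^+ 2).

End Defs.

(* Main.v *)
Require Import Defs.
From HB Require Import structures.
From mathcomp Require Import all_boot all_order all_algebra.
From mathcomp Require Import all_classical all_reals all_analysis.
From mathcomp Require Import complex ring lra.
From mathcomp Require mpoly.
Import Order.TTheory GRing.Theory Num.Theory.
Import numFieldNormedType.Exports.
Local Open Scope classical_set_scope.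
Local Open Scope ring_scope.

Set Implicit Arguments.
Unset Strict Implicit.
Unset Printing Implicit Defensive.

(* Induct on the number of variables, peeling off the outermost one.  Let [al]
   be the exponent of [f] that is lexicographically largest when the last
   variable is the most significant, and [c] its coefficient; the integral
   decays like [|c|^(-1/|al|)], uniformly in all other coefficients.  Write
   [al = (j, be)].  For fixed outer variable [t] the restricted phase has
   leading exponent [be] with coefficient [Q t], where [Q] is a polynomial of
   degree [j] with leading coefficient [c].
   If [be <> 0], then off the [e]-neighbourhoods of the real parts of the roots
   of [Q] one has [|Q t| >= |c| e^j] and the induction hypothesis applies; on
   these neighbourhoods, of total length at most [2 j e], the sup norm of the
   amplitude suffices.  Taking [|c| e^|al| = 1] balances the two.
   If [be = 0], the phase is [Q t], the inner integral of [g] is a C1 amplitude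
   in [t], and van der Corput's estimate for [Q] together with an integration
   by parts concludes. *)

(** * Lower bounds for real polynomials away from their roots *)

Lemma size_coef_neq0 (R : nzRingType) (Q : {poly R}) (j : nat) :
  (size Q <= j.+1)%N -> Q`_j != 0 -> size Q = j.+1.
Proof.
move=> sQ Qj; apply/eqP; rewrite eqn_leq sQ ltnNge.
by apply: contra Qj => /leq_sizeP/(_ j (leqnn j))/eqP.
Qed.

(** Factor [Q] over the complex numbers: for real [t] and a root [z], the modulus of [t - z] is at
    least [|t - Re z|]. The list [rs] consists of the real parts of all complex roots, with
    multiplicity. *)
Lemma horner_ge_prod (R : rcfType) (Q : {poly R}) : Q != 0 ->
  exists rs : seq R, size rs = (size Q).-1 /\
    forall t, `|lead_coef Q| * \prod_(r <- rs) `|t - r| <= `|Q.[t]|.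
Proof.
move=> Q0.
have [zs Qzs] := closed_field_poly_normal (map_poly (real_complex R) Q).
exists [seq complex.Re z | z <- zs]; split.
  rewrite size_map -(size_map_poly (real_complex R) Q) Qzs size_scale; last first.
    by rewrite lead_coef_eq0 map_poly_eq0.
  by rewrite size_prod_XsubC.
move=> t.
have -> : `|Q.[t]| = complex.Re `|(map_poly (real_complex R) Q).[real_complex R t]|.
  by rewrite horner_map normc_def/= expr0n addr0 sqrtr_sqr.
rewrite Qzs hornerZ horner_prod normrM lead_coef_map.
have -> : `|real_complex R (lead_coef Q)| = real_complex R `|lead_coef Q|.
  by rewrite normc_def/= expr0n addr0 sqrtr_sqr.
have Re_scale (a : R) z : complex.Re (real_complex R a * z) = a * complex.Re z.
  by case: z => x y; rewrite /= mul0r subr0.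
rewrite Re_scale ler_wpM2l// big_map normr_prod.
suff : real_complex R (\prod_(z <- zs) `|t - complex.Re z|) <=
    \prod_(z <- zs) `|('X - z%:P).[real_complex R t]|.
  by case: (\prod_(z <- zs) `|('X - z%:P).[_]|) => x y /=; rewrite lecE/= => /andP[].
rewrite rmorph_prod; apply: ler_prod => z _; apply/andP; split.
  by rewrite ler0c.
rewrite hornerXsubC; apply: le_trans (normc_ge_Re _).
by case: z.
Qed.

Lemma horner_ge_expr (R : rcfType) (Q : {poly R}) : Q != 0 ->
  exists rs : seq R, size rs = (size Q).-1 /\
    forall t e, 0 <= e -> (forall r, r \in rs -> e <= `|t - r|) ->
      `|lead_coef Q| * e ^+ (size Q).-1 <= `|Q.[t]|.
Proof.
move=> /horner_ge_prod[rs [rsQ Qge]]; exists rs; split=> // t e e0 ers.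
apply: le_trans (Qge t); rewrite ler_wpM2l// -rsQ {Qge rsQ}.
elim: rs ers => [|r rs IH] ers; first by rewrite expr0 big_nil.
rewrite big_cons exprS ler_pM ?exprn_ge0 ?ers ?mem_head//.
by apply: IH => s srs; rewrite ers// in_cons srs orbT.
Qed.

(** * Van der Corput's estimate in one variable *)

(** The mean value theorem applied to [g - f]. It serves as monotonicity of the integral, with
    antiderivatives in place of integrals. *)
Lemma derive_le_diff (R : realType) (f g f' g' : R -> R) (a b : R) : a <= b ->
  (forall x : R, a <= x <= b -> is_derive x 1 f (f' x)) ->
  (forall x : R, a <= x <= b -> is_derive x 1 g (g' x)) ->
  (forall x, a <= x <= b -> f' x <= g' x) ->
  f b - f a <= g b - g a.
Proof.
move=> ab df dg fg.
have dgf x : a <= x <= b -> is_derive x 1 (g - f) (g' x - f' x).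
  by move=> xab; have := df _ xab; have := dg _ xab => ? ?; exact: is_deriveB.
have [||c /[!in_itv]/= cab] := @MVT_segment R (g - f) (fun x => g' x - f' x) a b ab.
- by move=> x /[!in_itv]/= /andP[/ltW ax /ltW xb]; apply: dgf; rewrite ax xb.
- by apply: derivable_within_continuous => x /[!in_itv]/= /dgf[].
rewrite !fctE => gfE.
suff : 0 <= (g' c - f' c) * (b - a) by rewrite -gfE; lra.
by rewrite mulr_ge0 ?subr_ge0// fg.
Qed.

(** Each point of [s] cuts an interval into at most two pieces, so it at most doubles the bound. *)
Lemma split_bound (R : realType) (F : R -> R) (A A' B : R) (s : seq R) :
  (forall a b, A <= a -> a <= b -> b <= A' ->
    (forall r, r \in s -> ~~ (a < r < b)) -> `|F b - F a| <= B) ->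
  forall a b, A <= a -> a <= b -> b <= A' -> `|F b - F a| <= 2 ^+ size s * B.
Proof.
elim: s B => [|r s IH] B FB a b Aa ab bA; first by rewrite expr0 mul1r FB.
rewrite /= exprSr -mulrA; apply: (IH) Aa ab bA => {}a {}b Aa ab bA abs.
have [/andP[ar rb]|rab] := boolP (a < r < b); last first.
  have FabB : `|F b - F a| <= B.
    by apply: FB => // x; rewrite in_cons => /predU1P[->//|/abs].
  by have := le_trans (normr_ge0 _) FabB; lra.
have -> : F b - F a = (F b - F r) + (F r - F a) by ring.
apply: le_trans (ler_normD _ _) _; rewrite mulr2n mulrDl mul1r lerD//.
  apply: FB => // [||x]; [exact: le_trans Aa (ltW ar)|exact: ltW|].
  rewrite in_cons => /predU1P[->|/abs]; first by rewrite ltxx.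
  by apply: contra => /andP[rx ->]; rewrite (lt_trans ar rx).
apply: FB => // [||x]; [exact: ltW|exact: le_trans (ltW rb) bA|].
rewrite in_cons => /predU1P[->|/abs]; first by rewrite ltxx andbF.
by apply: contra => /andP[-> xr]; rewrite (lt_trans xr rb).
Qed.

(** The derivative of [S = sin Q / Q'] differs from [cos Q] by [sin Q * E'], where
    [E' = Q'' / Q' ^ 2] is nonnegative and is the derivative of [- 1 / Q']. So the increments of [F]
    and [S] differ by at most the increment of [- 1 / Q'], and the four boundary values involved are
    each at most [1 / e] in absolute value. *)
Lemma van_der_corput_monotone (R : realType) (F : R -> R) (Q : {poly R})
    (a b e : R) : a <= b -> 0 < e ->
  (forall x : R, a <= x <= b -> is_derive x 1 F (cos Q.[x])) ->
  (forall x, a <= x <= b -> e <= `|Q^`().[x]|) ->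
  (forall x, a <= x <= b -> 0 <= Q^`()^`().[x]) ->
  `|F b - F a| <= 4 / e.
Proof.
move=> ab e0 dF Q'e Q''0.
have Q'0 x : a <= x <= b -> Q^`().[x] != 0.
  by move=> /Q'e; rewrite -normr_gt0; exact: lt_le_trans.
pose E := fun x : R => (Q^`().[x])^-1.
pose S := fun x : R => sin Q.[x] * E x.
pose E' := fun x : R => Q^`()^`().[x] / Q^`().[x] ^+ 2.
have dE x : a <= x <= b -> is_derive x 1 E (- E' x).
  move=> /Q'0 Qx; apply: is_derive_eq; first exact: is_deriveV.
  by rewrite /E' scaleNr mulrC.
have dS x : a <= x <= b -> is_derive x 1 S (cos Q.[x] - sin Q.[x] * E' x).
  move=> xab; have := dE x xab => dEx.
  have dsin : is_derive x 1 (@sin R \o horner Q) (cos Q.[x] * Q^`().[x]).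
    exact: is_derive1_comp.
  suff -> : cos Q.[x] - sin Q.[x] * E' x =
      sin Q.[x] *: (- E' x) + E x *: (cos Q.[x] * Q^`().[x]).
    exact: (is_deriveM dsin dEx).
  by rewrite /E /GRing.scale /=; field; exact: Q'0.
have dFE x : a <= x <= b -> is_derive x 1 (F + E) (cos Q.[x] - E' x).
  by move=> xab; have := dE x xab; have := dF x xab => ? ?; exact: is_deriveD.
have dFBE x : a <= x <= b -> is_derive x 1 (F - E) (cos Q.[x] - - E' x).
  by move=> xab; have := dE x xab; have := dF x xab => ? ?; exact: is_deriveB.
have E'0 x : a <= x <= b -> 0 <= E' x.
  by move=> xab; rewrite divr_ge0 ?Q''0// sqr_ge0.
have h1 : S b - S a <= (F - E) b - (F - E) a.
  apply: (derive_le_diff ab dS dFBE) => x xab.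
  by have := E'0 x xab; have := sin_geN1 Q.[x]; nra.
have h2 : (F + E) b - (F + E) a <= S b - S a.
  apply: (derive_le_diff ab dFE dS) => x xab.
  by have := E'0 x xab; have := sin_le1 Q.[x]; nra.
rewrite /S !fctE /= in h1 h2.
have Ee x : a <= x <= b -> - e^-1 <= E x <= e^-1.
  by move=> xab; rewrite -ler_norml normfV lef_pV2 ?posrE ?normr_gt0 ?Q'0 ?Q'e.
have Se x : a <= x <= b -> - e^-1 <= sin Q.[x] * E x <= e^-1.
  move=> xab; rewrite -ler_norml normrM -[leRHS]mul1r ler_pM//.
    by rewrite ler_norml sin_geN1 sin_le1.
  by rewrite ler_norml Ee.
have aab : a <= a <= b by rewrite lexx.
have bab : a <= b <= b by rewrite ab lexx.
move: (Ee a aab) (Ee b bab) (Se a aab) (Se b bab) h1 h2.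
move=> /andP[? ?] /andP[? ?] /andP[? ?] /andP[? ?] h1 h2.
by rewrite ler_norml; apply/andP; split; lra.
Qed.

(** For nonzero [Q] the list holds the real parts of the complex roots, hence every real root. A
    change of sign on an interval would produce, by the intermediate value theorem, a root in its
    interior. *)
Lemma horner_constant_sign (R : rcfType) (Q : {poly R}) :
  exists s : seq R, (size s <= (size Q).-1)%N /\
  forall a b, a <= b -> (forall r, r \in s -> ~~ (a < r < b)) ->
    (forall x, a <= x <= b -> 0 <= Q.[x]) \/ (forall x, a <= x <= b -> Q.[x] <= 0).
Proof.
have [->|Q0] := eqVneq Q 0.
  by exists [::]; split=> // a b _ _; left=> x _; rewrite horner0.
have [s [sQ Qs]] := horner_ge_prod Q0.
exists s; split; first by rewrite sQ.
have rootQ x : Q.[x] = 0 -> x \in s.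
  move=> Qx; have := Qs x; rewrite Qx normr0 pmulr_rle0; last first.
    by rewrite normr_gt0 lead_coef_eq0.
  have p0 : 0 <= \prod_(r <- s) `|x - r| by exact: prodr_ge0.
  move=> p0'; have : \prod_(r <- s) `|x - r| == 0 by rewrite eq_le p0 p0'.
  by rewrite prodf_seq_eq0 => /hasP[r rs]; rewrite normr_eq0 subr_eq0 => /= /eqP ->.
move=> a b ab abs; apply: contrapT => /not_orP[].
move=> /existsNP[x /not_implyP[/andP[ax xb] /negP]]; rewrite -ltNge => Qx.
move=> /existsNP[y /not_implyP[/andP[ay yb] /negP]]; rewrite -ltNge => Qy.
(* The strict signs at [x] and [y] keep the root [z] away from both, hence away from the endpoints
   [a] and [b]. *)
have {Qx Qy} [z [zax zxb Qz]] : exists z, [/\ a < z, z < b & Q.[z] = 0].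
  have [xy|yx] := leP x y.
    have [||z /andP[xz zy] /rootP Qz] := @poly_ivt _ Q x y.
    - by [].
    - by rewrite !ltW.
    exists z; split=> //.
      rewrite (le_lt_trans ax)// lt_neqAle xz andbT; apply: contraTneq Qx => ->.
      by rewrite Qz ltxx.
    rewrite (lt_le_trans _ yb)// lt_neqAle zy andbT; apply: contraTneq Qy => <-.
    by rewrite Qz ltxx.
  have [||z /andP[yz zx] /rootP Qz] := @poly_ivt _ (- Q) y x.
  - exact: ltW.
  - by rewrite !hornerN oppr_le0 oppr_ge0 !ltW.
  move: Qz; rewrite hornerN => /eqP; rewrite oppr_eq0 => /eqP Qz.
  exists z; split=> //.
    rewrite (le_lt_trans ay)// lt_neqAle yz andbT; apply: contraTneq Qy => ->.
    by rewrite Qz ltxx.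
  rewrite (lt_le_trans _ xb)// lt_neqAle zx andbT; apply: contraTneq Qx => <-.
  by rewrite Qz ltxx.
by have := abs z (rootQ z Qz); rewrite zax zxb.
Qed.

(* The scale [e] satisfies [|c| e^(j+1) >= 1]: away from the [e]-neighbourhoods of
   the real parts of the roots of [Q'] one has [|Q'| >= 1/e], and these
   neighbourhoods have length [2 e]. *)
Lemma van_der_corput (R : realType) (F : R -> R) (Q : {poly R}) (j : nat)
    (a b e : R) : 0 < e -> size Q = j.+2 -> 1 <= `|lead_coef Q| * e ^+ j.+1 ->
  a <= b -> (forall x : R, a <= x <= b -> is_derive x 1 F (cos Q.[x])) ->
  `|F b - F a| <= 2 ^+ (3 * j) * (4 * e).
Proof.
move=> e0 sQ ce ab dF.
have Q'j : Q^`()`_j = lead_coef Q *+ j.+1 by rewrite coef_deriv lead_coefE sQ.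
have c0 : lead_coef Q != 0 by rewrite lead_coef_eq0 -size_poly_gt0 sQ.
have sQ' : size Q^`() = j.+1.
  apply/eqP; rewrite eqn_leq -ltnS -[X in (_ < X)%N]sQ lt_size_deriv; last first.
    by rewrite -size_poly_gt0 sQ.
  rewrite ltnNge; apply/negP => /leq_sizeP/(_ j (leqnn j)) /eqP.
  by rewrite Q'j mulrn_eq0/= (negbTE c0).
have Q'0 : Q^`() != 0 by rewrite -size_poly_gt0 sQ'.
have [rs [rsj Q'ge]] := horner_ge_expr Q'0.
have [s [sj Q''s]] := horner_constant_sign Q^`()^`().
(* Cut at the ends of the [e]-neighbourhoods and where the second derivative may change sign: at
   most [j] points of each of three kinds. A piece that comes closer than [e] to some [r] then lies
   in [[r - e, r + e]]; on every other piece the estimate for a monotone derivative applies. *)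
pose t := [seq r - e | r <- rs] ++ [seq r + e | r <- rs] ++ s.
have tj : (size t <= 3 * j)%N.
  rewrite !size_cat !size_map rsj sQ' /=.
  have : (size s <= j)%N.
    apply: leq_trans sj _; have := lt_size_deriv Q'0; rewrite sQ' ltnS.
    by move=> h; rewrite (leq_trans (leq_pred _)).
  by move=> ?; rewrite !mulSn mul0n addn0 leq_add2l leq_add2l.
apply: (@le_trans _ _ (2 ^+ size t * (4 * e))); last first.
  by rewrite ler_pM2r ?mulr_gt0// ler_weXn2l// ler1n.
apply: (@split_bound _ F a b) => // {ab}a' b' aa' ab bb' abt.
have {aa' bb'}dF x : a' <= x <= b' -> is_derive x 1 F (cos Q.[x]).
  by move=> /andP[ax xb]; apply: dF; rewrite (le_trans aa' ax) (le_trans xb bb').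
move: a' b' ab abt dF => {}a {}b ab abt dF.
have [near|far] := pselect (exists x r, [/\ a <= x <= b, r \in rs & `|x - r| < e]).
  have [x [r [/andP[ax xb] rrs]]] := near.
  rewrite ltr_norml => /andP[rx xr].
  have ar : r - e <= a.
    have /abt : r - e \in t by rewrite mem_cat (map_f (fun r => r - e)).
    by rewrite leNgt; apply: contra => ->; rewrite /=; lra.
  have rb : b <= r + e.
    have /abt : r + e \in t by rewrite !mem_cat (map_f (fun r => r + e)) ?orbT.
    by rewrite leNgt; apply: contra => ->; rewrite andbT; lra.
  have dcst (k y : R) : is_derive y 1 (fun y : R => k * y) k.
    have : is_derive y 1 (k \*: (@id R)) (k *: (1 : R)) by exact: is_deriveZ.
    by rewrite /GRing.scale/= mulr1.
  (* On a piece of length at most [2 * e], bounding the cosine by 1 is enough. *)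
  have h1 : F b - F a <= 1 * b - 1 * a.
    by apply: (@derive_le_diff _ _ _ (fun x => cos Q.[x]) (fun=> 1) a b) => //
      y yab; exact: cos_le1.
  have h2 : -1 * b - -1 * a <= F b - F a.
    by apply: (@derive_le_diff _ _ _ (fun=> -1) (fun x => cos Q.[x]) a b) => //
      y yab; exact: cos_geN1.
  by rewrite ler_norml; apply/andP; split; lra.
have Q'x x : a <= x <= b -> e^-1 <= `|Q^`().[x]|.
  move=> xab.
  have : `|lead_coef Q^`()| * e ^+ (size Q^`()).-1 <= `|Q^`().[x]|.
    apply: Q'ge => [|r rrs]; first exact: ltW.
    by rewrite leNgt; apply/negP => xr; apply: far; exists x, r.
  rewrite sQ' /=; apply: le_trans.
  have -> : lead_coef Q^`() = lead_coef Q *+ j.+1 by rewrite lead_coefE sQ'.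
  rewrite normrMn mulrnAl.
  (* The factor [j.+1] produced by differentiating the leading term is at least 1 and is dropped. *)
  rewrite mulrS (@le_trans _ _ (`|lead_coef Q| * e ^+ j))//.
    by rewrite -[leLHS]mul1r ler_pdivrMr// -mulrA -exprSr.
  by rewrite lerDl mulrn_wge0// mulr_ge0// exprn_ge0// ltW.
have -> : 4 * e = 4 / e^-1 by rewrite invrK.
have [|Q''0|Q''0] := Q''s a b ab.
- by move=> r rs'; apply: abt; rewrite !mem_cat rs' !orbT.
- by apply: (van_der_corput_monotone (Q := Q)) => //; rewrite invr_gt0.
(* Passing to [- Q] makes the second derivative nonnegative and, the cosine being even, keeps
   [F]. *)
- apply: (van_der_corput_monotone (Q := - Q)) => //; first by rewrite invr_gt0.
  + by move=> x xab; rewrite hornerN cosN; exact: dF.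
  + by move=> x xab; rewrite derivN hornerN normrN Q'x.
  + by move=> x xab; rewrite !derivN hornerN oppr_ge0 Q''0.
Qed.

(** * Slicing off the outermost coordinate *)

Lemma cvg_rV (R : realType) (T : Type) (F : set_system T) (n : nat)
    (f : T -> 'rV[R]_n) (l : 'rV[R]_n) : Filter F ->
  (forall j, f x 0 j @[x --> F] --> l 0 j) -> f @ F --> l.
Proof.
move=> FF fl A [P lP PA].
have : \forall x \near F, forall j, P 0 j (f x 0 j).
  by apply: filter_forall => j; apply: fl; exact: lP.
by apply: filterS => x Px; apply: PA => i j; rewrite ord1; exact: Px.
Qed.

(** The same row as in the successor case of [integral_Rn], so that unfolding the iterated integral
    once yields inner integrals over [slice t v] by conversion. *)
Definition slice (R : realType) (n : nat) (t : R) (v : 'rV[R]_n) : 'rV[R]_n.+1 :=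
  \row_(i < n.+1) match unlift ord0 i with None => t | Some j => v 0 j end.

Section slice.
Variables (R : realType) (n : nat).
Implicit Types (t : R) (v : 'rV[R]_n).

Lemma slice0 t v : slice t v 0 ord0 = t.
Proof. by rewrite mxE unlift_none. Qed.

Lemma sliceS t v j : slice t v 0 (lift ord0 j) = v 0 j.
Proof. by rewrite mxE liftK. Qed.

Lemma slice_addl t h v : slice (h + t) v = h *: evec R ord0 + slice t v.
Proof.
apply/rowP => i; rewrite /evec !mxE /=; case: unliftP => [j ->|->].
  by rewrite mulr0 add0r.
by rewrite mulr1.
Qed.

Lemma slice_addr t h v j :
  slice t (h *: evec R j + v) = h *: evec R (lift ord0 j) + slice t v.
Proof.
apply/rowP => i; rewrite /evec !mxE /=; case: unliftP => [k ->|->].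
  by rewrite !mxE /= (inj_eq lift_inj).
by rewrite -(inj_eq val_inj)/= mulr0 add0r.
Qed.

Lemma continuous_slice : continuous (fun z : R * 'rV[R]_n => slice z.1 z.2).
Proof.
move=> [t v]; apply: cvg_rV => j.
have [k ->|->] := unliftP ord0 j.
  have -> : (fun z : R * 'rV[R]_n => slice z.1 z.2 0 (lift ord0 k)) =
      (fun v : 'rV[R]_n => v 0 k) \o snd.
    by apply/funext => z; rewrite /= sliceS.
  rewrite sliceS; apply: continuous_comp; first exact: cvg_snd.
  exact: coord_continuous.
have -> : (fun z : R * 'rV[R]_n => slice z.1 z.2 0 ord0) = fst.
  by apply/funext => z; rewrite slice0.
by rewrite slice0; exact: cvg_fst.
Qed.

End slice.

(** * Iterated integrals of bounded continuous functions supported in a box *)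

Definition in_box (R : realType) (n : nat) (M : R) (v : 'rV[R]_n) :=
  forall i, `|v 0 i| <= M.

(** A class of integrands stable under slicing, for which every partial integration is legitimate.
    The half-side [M] of the box is the same in all dimensions. *)
Definition tame (R : realType) (n : nat) (M B : R) (F : 'rV[R]_n -> R) :=
  [/\ continuous F, forall v, F v != 0 -> in_box M v & forall v, `|F v| <= B].

(** Continuity is joint and both bounds are uniform in [t], as dominated convergence requires. The
    support in [t] is not restricted, so that constant families qualify. *)
Definition tame_family (R : realType) (n : nat) (M B : R)
    (F : R -> 'rV[R]_n -> R) :=
  [/\ continuous (fun z : R * 'rV[R]_n => F z.1 z.2),
      forall t v, F t v != 0 -> in_box M v & forall t v, `|F t v| <= B].

Section tame.
Variables (R : realType) (M : R).
Hypothesis M0 : 0 <= M.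
Notation mu := (@lebesgue_measure R).

(** The integrable majorant used in all domination arguments over one coordinate. *)
Definition plateau (B t : R) : R := B * \1_`[- M, M] t.

Lemma plateau_ge0 B t : 0 <= B -> 0 <= plateau B t.
Proof. by move=> B0; rewrite mulr_ge0. Qed.

Lemma integrable_plateau B : mu.-integrable setT (EFin \o plateau B).
Proof.
have -> : EFin \o plateau B =
    (fun t => (B%:E * (EFin \o (\1_`[- M, M] : R -> R)%R) t)%E).
  by apply/funext => t; rewrite /= EFinM.
by apply: integrableZl => //; exact: integrable_indic_itv.
Qed.

Lemma Rintegral_indic (a b : R) : a <= b ->
  \int[mu]_t (\1_`[a, b] t : R) = b - a.
Proof.
move=> ab; rewrite /Rintegral integral_indic// setIT.
etransitivity; first exact: (congr1 fine (lebesgue_measure_itv `[a, b])).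
rewrite /=.
by rewrite lte_fin; case: ltgtP ab => //= -> _; rewrite subrr.
Qed.

Lemma Rintegral_plateau B : \int[mu]_t plateau B t = B * (2 * M).
Proof.
rewrite RintegralZl//; last exact: integrable_indic_itv.
have MM : - M <= M by have := M0; lra.
by rewrite Rintegral_indic//; congr (_ * _); ring.
Qed.

Lemma le_plateau (f : R -> R) (B : R) : 0 <= B ->
  (forall t, f t != 0 -> `|t| <= M) -> (forall t, `|f t| <= B) ->
  forall t, `|f t| <= plateau B t.
Proof.
move=> B0 fM fB t; have [ft0|ft0] := eqVneq (f t) 0.
  by rewrite ft0 normr0 plateau_ge0.
by rewrite /plateau indicE mem_set ?mulr1//= in_itv/= -ler_norml fM.
Qed.

Lemma integrable_le_plateau (f : R -> R) (B : R) : continuous f -> 0 <= B ->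
  (forall t, `|f t| <= plateau B t) -> mu.-integrable setT (EFin \o f).
Proof.
move=> cf B0 fB; apply: le_integrable (integrable_plateau B) => //.
  apply/measurable_realfun.measurable_EFinP.
  exact: measurable_realfun.continuous_measurable_fun.
by move=> t _; rewrite /= lee_fin (ger0_norm (plateau_ge0 _ B0)).
Qed.

Lemma continuous_pair (T U V : topologicalType) (f : T -> U) (g : T -> V) :
  continuous f -> continuous g -> continuous (fun x => (f x, g x)).
Proof. by move=> cf cg x; apply: cvg_pair; [exact: cf|exact: cg]. Qed.

Lemma tame_slice n B (F : 'rV[R]_n.+1 -> R) : tame M B F ->
  tame_family M B (fun t v => F (slice t v)).
Proof.
move=> [cF sF bF]; split=> // [z|t v /sF Fv i].
  by apply: continuous_comp; [exact: continuous_slice|exact: cF].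
by rewrite -(sliceS t).
Qed.

Lemma tame_family_fix n B (F : R -> 'rV[R]_n -> R) t : tame_family M B F ->
  tame M B (F t).
Proof.
move=> [cF sF bF]; split=> // [v|v]; last exact: sF.
apply: (@continuous_comp _ _ _ (fun v => (t, v)) (fun z => F z.1 z.2)).
  by apply: continuous_pair; [exact: cst_continuous|move=> ?; exact: cvg_id].
exact: cF.
Qed.

Lemma tame_family_slice n B (F : R -> 'rV[R]_n.+1 -> R) s : tame_family M B F ->
  tame_family M B (fun t v => F t (slice s v)).
Proof.
move=> [cF sF bF]; split=> // [z|t v /sF Fv i]; last by rewrite -(sliceS s).
apply: (@continuous_comp _ _ _ (fun z : R * 'rV[R]_n => (z.1, slice s z.2))
  (fun z => F z.1 z.2)); last exact: cF.
apply: continuous_pair => [?|{}z]; first exact: cvg_fst.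
apply: (@continuous_comp _ _ _ (fun z : R * 'rV[R]_n => (s, z.2))
  (fun z => slice z.1 z.2)); last exact: continuous_slice.
by apply: (continuous_pair (g := snd)) => ?; [exact: cvg_cst|exact: cvg_snd].
Qed.

Lemma integral_Rn0 n : integral_Rn (fun _ : 'rV[R]_n => 0 : R) = 0.
Proof. by elim: n => //= n IH; rewrite IH /Rintegral integral0. Qed.

Lemma tame_slice_support n B (F : 'rV[R]_n.+1 -> R) : tame M B F ->
  forall t, integral_Rn (fun v => F (slice t v)) != 0 -> `|t| <= M.
Proof.
move=> [_ sF _] t; apply: contra_neqT => tM.
rewrite -(integral_Rn0 n); congr integral_Rn; apply/funext => v.
by apply: contraNeq tM => /sF/(_ ord0); rewrite slice0.
Qed.

(** The outer integral is continuous in [t] by dominated convergence. This takes from dimension [n]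
    both the continuity in [t] of the inner integral at fixed [s] and its bound, turned into a
    [plateau] in [s]; hence the joint induction. *)
Lemma integral_family n B (F : R -> 'rV[R]_n -> R) : 0 <= B ->
  tame_family M B F ->
  continuous (fun t => integral_Rn (F t)) /\
  forall t, `|integral_Rn (F t)| <= B * (2 * M) ^+ n.
Proof.
move=> B0; elim: n F => [|n IH] F tF.
  have [cF _ bF] := tF; split=> [t|t]; last by rewrite expr0 mulr1 bF.
  apply: (@continuous_comp _ _ _ (fun t : R => (t, 0 : 'rV[R]_0))
    (fun z => F z.1 z.2)).
    by apply: continuous_pair; [move=> ?; exact: cvg_id|exact: cst_continuous].
  exact: cF.
have BM0 : 0 <= B * (2 * M) ^+ n by rewrite mulr_ge0// exprn_ge0// mulr_ge0.
have tFt t := tame_slice (tame_family_fix t tF).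
have Ftb t s : `|integral_Rn (fun v => F t (slice s v))| <=
    plateau (B * (2 * M) ^+ n) s.
  apply: (@le_plateau (fun s => integral_Rn (fun v => F t (slice s v))) _ BM0) =>
    [{}s|{}s]; last by have [_] := IH _ (tFt t); exact.
  exact: (tame_slice_support (tame_family_fix t tF)).
have Fti t : mu.-integrable setT
    (EFin \o (fun s => integral_Rn (fun v => F t (slice s v)))).
  by apply: integrable_le_plateau (Ftb t) => //; have [] := IH _ (tFt t).
split=> [t|t]; last first.
  have -> : B * (2 * M) ^+ n.+1 = \int[mu]_t plateau (B * (2 * M) ^+ n) t.
    by rewrite Rintegral_plateau exprS; ring.
  apply: le_trans (le_normr_Rintegral measurableT (Fti t)) _.
  apply: le_Rintegral => //; first exact: integrable_norm (Fti t).
  exact: integrable_plateau.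
apply: (@continuity_under_integral _ _ _ mu
  (fun t s => integral_Rn (fun v => F t (slice s v))) setT measurableT
  (t - 1) (t + 1) _ _ _ (integrable_plateau (B * (2 * M) ^+ n))) => //.
- apply/aeW => s _ x _; have [] := IH _ (tame_family_slice s tF).
  exact.
- by move=> x _; apply/aeW => s _; exact: Ftb.
- by rewrite inE/= in_itv/=; apply/andP; split; lra.
Qed.

Lemma tame_bound_ge0 n B (F : 'rV[R]_n -> R) : tame M B F -> 0 <= B.
Proof. by move=> [_ _ /(_ 0)]; exact: le_trans. Qed.

Lemma norm_integral_le n B (F : 'rV[R]_n -> R) : tame M B F ->
  `|integral_Rn F| <= B * (2 * M) ^+ n.
Proof.
move=> tF; have [cF sF bF] := tF.
have tF2 : tame_family M B (fun _ : R => F).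
  split=> // z.
  by apply: (@continuous_comp _ _ _ snd F); [exact: cvg_snd|exact: cF].
by have [_ /(_ 0)] := integral_family (tame_bound_ge0 tF) tF2.
Qed.

Lemma continuous_integral_slice n B (F : 'rV[R]_n.+1 -> R) : tame M B F ->
  continuous (fun t => integral_Rn (fun v => F (slice t v))).
Proof.
move=> tF; have [] // := integral_family (tame_bound_ge0 tF) (tame_slice tF).
Qed.

Lemma norm_integral_slice n B (F : 'rV[R]_n.+1 -> R) t : tame M B F ->
  `|integral_Rn (fun v => F (slice t v))| <= plateau (B * (2 * M) ^+ n) t.
Proof.
move=> tF; have B0 := tame_bound_ge0 tF.
apply: (@le_plateau (fun t => integral_Rn (fun v => F (slice t v)))).
- by rewrite mulr_ge0// exprn_ge0// mulr_ge0.
- exact: tame_slice_support tF.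
- by have [_] := integral_family B0 (tame_slice tF).
Qed.

Lemma integrable_slice n B (F : 'rV[R]_n.+1 -> R) : tame M B F ->
  mu.-integrable setT
    (EFin \o (fun t => integral_Rn (fun v => F (slice t v)))).
Proof.
move=> tF; apply: (@integrable_le_plateau _ (B * (2 * M) ^+ n)) => [||t].
- exact: continuous_integral_slice tF.
- by rewrite mulr_ge0 ?(tame_bound_ge0 tF)// exprn_ge0// mulr_ge0.
- exact: norm_integral_slice tF.
Qed.

Lemma tameZ n B a (F : 'rV[R]_n -> R) : tame M B F ->
  tame M (`|a| * B) (fun v => a * F v).
Proof.
move=> [cF sF bF]; split=> [v|v|v].
- by apply: continuousM; [exact: cst_continuous|exact: cF].
- by rewrite mulf_eq0 negb_or => /andP[_]; exact: sF.
- by rewrite normrM ler_wpM2l.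
Qed.

Lemma integral_RnZ n B a (F : 'rV[R]_n -> R) : tame M B F ->
  integral_Rn (fun v => a * F v) = a * integral_Rn F.
Proof.
elim: n F => [//|n IH] F tF; rewrite /=.
rewrite -RintegralZl//; last exact: integrable_slice tF.
apply: eq_Rintegral => t _.
by rewrite -(IH _ (tame_family_fix t (tame_slice tF))).
Qed.

Lemma le_integral_Rn n B B' (F G : 'rV[R]_n -> R) : tame M B F -> tame M B' G ->
  (forall v, F v <= G v) -> integral_Rn F <= integral_Rn G.
Proof.
elim: n F G => [|n IH] F G tF tG FG; first exact: FG.
apply: le_Rintegral => //; [exact: integrable_slice tF|exact: integrable_slice tG|].
move=> t _; apply: IH => [||v]; last exact: FG.
  exact: tame_family_fix t (tame_slice tF).
exact: tame_family_fix t (tame_slice tG).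
Qed.

Lemma norm_integral_Rn n B B' (F G : 'rV[R]_n -> R) : tame M B F ->
  tame M B' G -> (forall v, `|F v| <= G v) -> `|integral_Rn F| <= integral_Rn G.
Proof.
move=> tF tG FG; rewrite ler_norml; apply/andP; split.
  rewrite lerNl -mulN1r -(integral_RnZ _ tF).
  apply: le_integral_Rn (tameZ _ tF) tG _ => v.
  by rewrite mulN1r (le_trans (ler_norm _))// normrN.
by apply: le_integral_Rn tF tG _ => v; exact: le_trans (ler_norm _) (FG v).
Qed.

(** For each first coordinate [s] the induction hypothesis differentiates the remaining integral; a
    [plateau] bounding that derivative uniformly in the parameter then allows differentiation under
    the integral over [s]. *)
Lemma is_derive_integral_Rn n B B' (F F' : R -> 'rV[R]_n -> R) :
  tame_family M B F -> tame_family M B' F' ->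
  (forall (t : R) v, is_derive t 1 (F^~ v) (F' t v)) ->
  forall t : R, is_derive t 1 (fun t => integral_Rn (F t)) (integral_Rn (F' t)).
Proof.
elim: n F F' => [|n IH] F F' tF tF' dF t; first exact: (dF t 0).
pose f t s := integral_Rn (fun v => F t (slice s v)).
pose f' t s := integral_Rn (fun v => F' t (slice s v)).
have df (s r : R) : is_derive r 1 (f^~ s) (f' r s).
  exact: IH (tame_family_slice s tF) (tame_family_slice s tF') _ r.
have tFt r := tame_family_fix r tF; have tF't r := tame_family_fix r tF'.
pose K := B' * (2 * M) ^+ n.
have K0 : 0 <= K.
  by rewrite mulr_ge0 ?(tame_bound_ge0 (tF't 0))// exprn_ge0// mulr_ge0.
have d1 r s : partial1of2 f r s = f' r s.
  by rewrite partial1of2E; have [_ ->] := df s r.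
have := @cvg_differentiation_under_integral _ _ _ mu f setT measurableT t
  (t - 1) (t + 1) _ _ _ (plateau K) _ (integrable_plateau K) _.
have -> : (\int[mu]_(y in setT) partial1of2 f t y) = integral_Rn (F' t).
  by apply: eq_Rintegral => s _; rewrite d1.
move=> cv.
have {}cv : h^-1 *: (integral_Rn (F (h *: 1 + t)) - integral_Rn (F t)) @[h --> 0^']
    --> integral_Rn (F' t).
  under eq_fun do rewrite [_ *: 1]mulr1.
  apply: cv => [|r _|r s _ _|s|r s _ _].
  - by rewrite /= in_itv/=; apply/andP; split; lra.
  - exact: integrable_slice (tFt r).
  - by have [] := df s r.
  - exact: plateau_ge0.
  - by rewrite d1; exact: norm_integral_slice (tF't r).
by apply: DeriveDef; [apply/cvg_ex; exists (integral_Rn (F' t))|exact: cvg_lim].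
Qed.

End tame.

(** * Test functions and their gradients *)

(** [S] is any bound of [|g|] rather than its supremum, so that one [S] serves all slices of [g].
    The bound on the partial derivatives is existential, since the estimates see the gradient only
    through [grad_L1]. *)
Definition test_function (R : realType) (n : nat) (M S : R) (g : 'rV[R]_n -> R) :=
  [/\ tame M S g, forall i v, derivable g v (evec R i)
    & exists B, forall i, tame M B (partial i g)].

Section test_function.
Variables (R : realType) (M : R).

Lemma quotient_slice n (g : 'rV[R]_n.+1 -> R) t (i : 'I_n) v :
  (fun h : R => h^-1 *: (((fun v => g (slice t v)) \o shift v) (h *: evec R i)
    - g (slice t v))) =
  (fun h : R => h^-1 *: ((g \o shift (slice t v)) (h *: evec R (lift ord0 i))
    - g (slice t v))).
Proof. by apply/funext => h; rewrite /= slice_addr. Qed.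

Lemma partial_slice n (g : 'rV[R]_n.+1 -> R) t (i : 'I_n) v :
  partial i (fun v => g (slice t v)) v = partial (lift ord0 i) g (slice t v).
Proof. by rewrite /partial /derive quotient_slice. Qed.

Lemma derivable_slice n (g : 'rV[R]_n.+1 -> R) t (i : 'I_n) v :
  derivable g (slice t v) (evec R (lift ord0 i)) ->
  derivable (fun v => g (slice t v)) v (evec R i).
Proof. by rewrite /derivable quotient_slice. Qed.

Lemma is_derive_slice n (g : 'rV[R]_n.+1 -> R) (t : R) v :
  derivable g (slice t v) (evec R ord0) ->
  is_derive t 1 (fun t => g (slice t v)) (partial ord0 g (slice t v)).
Proof.
move=> dg.
have E : (fun h : R => h^-1 *:
      (((fun t => g (slice t v)) \o shift t) (h *: 1) - g (slice t v))) =
    (fun h => h^-1 *: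
      ((g \o shift (slice t v)) (h *: evec R ord0) - g (slice t v))).
  by apply/funext => h; rewrite /= [_ *: 1]mulr1 slice_addl.
by apply: DeriveDef; rewrite /derivable /partial /derive E.
Qed.

Lemma test_function_slice n S (g : 'rV[R]_n.+1 -> R) t : test_function M S g ->
  test_function M S (fun v => g (slice t v)).
Proof.
move=> [tg dg [B tpg]]; split.
- exact: tame_family_fix t (tame_slice tg).
- by move=> i v; apply: derivable_slice; exact: dg.
- exists B => i.
  have -> : partial i (fun v => g (slice t v)) =
      (fun v => partial (lift ord0 i) g (slice t v)).
    by apply/funext => v; rewrite partial_slice.
  exact: tame_family_fix t (tame_slice (tpg _)).
Qed.

Lemma tame_grad_norm n S (g : 'rV[R]_n -> R) : test_function M S g ->
  exists B, tame M B (grad_norm g).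
Proof.
move=> [tg dg [B tpg]]; exists (Num.sqrt (n%:R * B ^+ 2)); split.
- move=> v; apply: continuous_comp; last exact: sqrt_continuous.
  apply: (@continuous_big R 'I_n +%R 0 predT _ 'rV[R]_n) => [|i _ w].
    exact: add_continuous.
  have [cp _ _] := tpg i.
  exact: (@continuous_comp _ _ _ (partial i g) (fun x => x ^+ 2) w (cp w)
    (@exprn_continuous _ 2 _)).
- move=> v gv; have : \sum_(i < n) partial i g v ^+ 2 != 0.
    by apply: contraNneq gv => gv; rewrite /grad_norm gv sqrtr0.
  apply: contra_neqP => Mv; apply: big1 => i _; apply/eqP; rewrite sqrf_eq0.
  by apply: contra_notT Mv => gv'; have [_ + _] := tpg i; exact.
- move=> v; rewrite ger0_norm ?sqrtr_ge0// ler_wsqrtr//.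
  rewrite -[n in leRHS]card_ord mulr_natl -sumr_const; apply: ler_sum => i _.
  have [_ _ /(_ v) gB] := tpg i; rewrite -(real_normK (num_real (partial i g v))).
  by rewrite ler_sqr ?nnegrE// (le_trans _ gB).
Qed.

(** The gradient of a slice lacks the component along [t]. Hence [grad_L1] of the slices, integrated
    over [t], stays below [grad_L1 g]. *)
Lemma grad_norm_slice n (g : 'rV[R]_n.+1 -> R) t v :
  grad_norm (fun v => g (slice t v)) v <= grad_norm g (slice t v).
Proof.
rewrite /grad_norm ler_wsqrtr// big_ord_recl /=.
under eq_bigr do rewrite partial_slice.
by rewrite lerDr sqr_ge0.
Qed.

Lemma partial_le_grad_norm n (g : 'rV[R]_n -> R) i v :
  `|partial i g v| <= grad_norm g v.
Proof.
rewrite -sqrtr_sqr /grad_norm ler_wsqrtr// (bigD1 i)//= lerDl.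
by apply: sumr_ge0 => j _; exact: sqr_ge0.
Qed.

End test_function.

(** * Leading exponents of polynomial phases *)

(* For a polynomial [Phi]: all its exponents are at most [al] in the
   lexicographic order that compares the last (innermost) variable first, and
   [c], possibly zero, is its coefficient at [al]. *)
Fixpoint phase (R : realType) (n : nat) (al : seq nat) (c : R) :
    ('rV[R]_n -> R) -> Prop :=
  match n return ('rV[R]_n -> R) -> Prop with
  | 0 => fun Phi => forall v, Phi v = c
  | n'.+1 => fun Phi => exists Q : {poly R},
      [/\ (size Q <= (head 0 al).+1)%N, Q`_(head 0 al) = c &
          forall t, phase (behead al) Q.[t] (fun v => Phi (slice t v))]
  end.

(** A zero exponent forces every [Q] in [phase] to have size at most 1, hence to be constant. *)
Lemma phase_const (R : realType) n al c (Phi : 'rV[R]_n -> R) :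
  sumn al = 0%N -> phase al c Phi -> forall v, Phi v = c.
Proof.
elim: n al c Phi => [//|n IH] al c Phi al0 [Q [sQ Qc PhiQ]] v.
have [h0 b0] : head 0 al = 0%N /\ sumn (behead al) = 0%N.
  case: al al0 {sQ Qc PhiQ} => //= a al /eqP.
  by rewrite addn_eq0 => /andP[/eqP -> /eqP].
have -> : v = slice (v 0 ord0) (\row_j v 0 (lift ord0 j)).
  apply/rowP => i; rewrite !mxE; case: unliftP => [j ->|->//].
  by rewrite mxE.
have -> := IH _ _ _ b0 (PhiQ (v 0 ord0)).
move: sQ Qc; rewrite h0 => /size1_polyC ->.
by rewrite hornerC coefC.
Qed.

(** Serves to multiply the phase by [lam] and to shift it by a constant, which turns the sine into a
    cosine. The shift reaches the leading coefficient only when the leading exponent is zero. *)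
Lemma phase_affine (R : realType) n al c (Phi : 'rV[R]_n -> R) a b :
  size al = n -> phase al c Phi ->
  phase al (a * c + (if sumn al == 0%N then b else 0)) (fun v => a * Phi v + b).
Proof.
elim: n al c Phi => [|n IH] [|j al]//= c Phi.
  by move=> _ Phic v; rewrite Phic.
move=> [aln] [Q [sQ Qc PhiQ]].
pose b' := if sumn al == 0%N then b else 0.
exists (a *: Q + b'%:P); split.
- apply: leq_trans (size_polyD _ _) _; rewrite geq_max.
  by rewrite (leq_trans (size_scale_leq _ _))// (leq_trans (size_polyC_leq1 _)).
- rewrite coefD coefZ Qc coefC /b' addn_eq0; congr (_ + _).
  by case: (j == 0%N).
- by move=> t; rewrite hornerD hornerZ hornerC; apply: IH.
Qed.

(** * Inductive step: oscillation in the inner variables *)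

Section oscillatory.
Variables (R : realType) (M : R).
Hypothesis M0 : 0 <= M.
Notation mu := (@lebesgue_measure R).

Lemma integrable_EFinZ (k : R) (f : R -> R) : mu.-integrable setT (EFin \o f) ->
  mu.-integrable setT (EFin \o (fun t => k * f t)).
Proof.
have -> : EFin \o (fun t => k * f t) = (fun t => (k%:E * (EFin \o f) t)%E).
  by apply/funext => t; rewrite /= EFinM.
exact: integrableZl.
Qed.

Lemma integrable_EFinD (f g : R -> R) : mu.-integrable setT (EFin \o f) ->
  mu.-integrable setT (EFin \o g) ->
  mu.-integrable setT (EFin \o (fun t => f t + g t)).
Proof.
have -> : EFin \o (fun t => f t + g t) = ((EFin \o f) \+ (EFin \o g))%E.
  by apply/funext => t; rewrite /= EFinD.
exact: integrableD.
Qed.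

(** Neighbourhoods are counted with multiplicity: the sum is at least 1 on their union, and its
    integral is explicit even when they overlap. *)
Definition wells (rs : seq R) (e t : R) : R :=
  \sum_(r <- rs) \1_`[r - e, r + e] t.

Lemma wells_ge0 rs e t : 0 <= wells rs e t.
Proof. by apply: sumr_ge0 => r _; rewrite indicE. Qed.

Lemma Rintegral_wells rs e : 0 <= e ->
  mu.-integrable setT (EFin \o wells rs e) /\
  \int[mu]_t wells rs e t = (size rs)%:R * (2 * e).
Proof.
move=> e0; elim: rs => [|r rs [IH1 IH2]].
  have -> : wells [::] e = cst 0 by apply/funext => t; rewrite /wells big_nil.
  by split; [exact: integrable0|rewrite /Rintegral integral0/= mul0r].
have W : wells (r :: rs) e = (fun t => \1_`[r - e, r + e] t + wells rs e t).
  by apply/funext => t; rewrite /wells big_cons.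
have i1 : mu.-integrable setT (EFin \o (\1_`[r - e, r + e] : R -> R)).
  exact: integrable_indic_itv.
rewrite W; split; first exact: integrable_EFinD.
rewrite RintegralD// IH2 Rintegral_indic; last by lra.
by rewrite /= -natr1; ring.
Qed.

Lemma tame_cos n S (Phi g : 'rV[R]_n -> R) : continuous Phi -> tame M S g ->
  tame M S (fun v => cos (Phi v) * g v).
Proof.
move=> cPhi [cg sg bg]; split.
- move=> v; apply: (@continuousM _ _ (fun v => cos (Phi v)) g); last exact: cg.
  by apply: continuous_comp; [exact: cPhi|exact: continuous_cos].
- by move=> v; rewrite mulf_eq0 negb_or => /andP[_]; exact: sg.
- move=> v; rewrite normrM -[leRHS]mul1r ler_pM//.
  by rewrite ler_norml cos_geN1 cos_le1.
Qed.

Lemma continuous_slice_fix n (Phi : 'rV[R]_n.+1 -> R) t : continuous Phi ->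
  continuous (fun v => Phi (slice t v)).
Proof.
move=> cPhi v; apply: continuous_comp; last exact: cPhi.
apply: (@continuous_comp _ _ _ (fun v : 'rV[R]_n => (t, v))
  (fun z => slice z.1 z.2)); last exact: continuous_slice.
by apply: continuous_pair; [exact: cst_continuous|move=> ?; exact: cvg_id].
Qed.

Lemma grad_L1_ge0 n (g : 'rV[R]_n -> R) S : test_function M S g -> 0 <= grad_L1 g.
Proof.
move=> tg; have [B tN] := tame_grad_norm tg.
rewrite -(integral_Rn0 R n) /grad_L1; apply: (le_integral_Rn M0 (B := 0)) tN _.
  by split=> [|v|v]; [exact: cst_continuous|rewrite eqxx|rewrite normr0].
by move=> v; exact: sqrtr_ge0.
Qed.

(** In the constant, [2 * M + 1] covers the inner estimate integrated over [[-M, M]], with factor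
    [2 * M] on [S] and 1 on [grad_L1 g]. The other term is the total length [2 * j * e] of the wells
    times the bound [S * (2 * M) ^ n] of the inner integral. *)
Lemma oscillatory_step n (al : seq nat) (j : nat) (C : R) : 0 <= C ->
  (forall (Phi g : 'rV[R]_n -> R) c S e, continuous Phi -> test_function M S g ->
    phase al c Phi -> 0 < e -> 1 <= `|c| * e ^+ sumn al ->
    `|integral_Rn (fun v => cos (Phi v) * g v)| <= C * e * (S + grad_L1 g)) ->
  forall (Phi g : 'rV[R]_n.+1 -> R) c S e, continuous Phi -> test_function M S g ->
    phase (j :: al) c Phi -> 0 < e -> 1 <= `|c| * e ^+ sumn (j :: al) ->
    `|integral_Rn (fun v => cos (Phi v) * g v)| <=
      (C * (2 * M + 1) + 2 * j%:R * (2 * M) ^+ n) * e * (S + grad_L1 g).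
Proof.
move=> C0 IH Phi g c S e cPhi tg [Q [/= sQ Qc PhiQ]] e0 ce.
have [tg0 _ _] := tg.
have S0 := tame_bound_ge0 tg0.
have c0 : c != 0 by apply: contraTneq ce => ->; rewrite normr0 mul0r lt_geF.
have {}sQ : size Q = j.+1 by apply: size_coef_neq0; rewrite ?Qc.
have lQ : lead_coef Q = c by rewrite lead_coefE sQ.
have Q0 : Q != 0 by rewrite -size_poly_gt0 sQ.
have [rs [rsj Qge]] := horner_ge_expr Q0.
rewrite sQ /= in rsj Qge.
have [B tN] := tame_grad_norm tg.
have tF := tame_cos cPhi tg0.
pose H t := integral_Rn (fun v => cos (Phi (slice t v)) * g (slice t v)).
pose N t := integral_Rn (fun v => grad_norm g (slice t v)).
pose V : R := (2 * M) ^+ n.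
have V0 : 0 <= V by rewrite exprn_ge0// mulr_ge0.
have N0 t : 0 <= N t.
  rewrite /N -(integral_Rn0 R n).
  apply: (le_integral_Rn M0 (B := 0)) (tame_family_fix t (tame_slice tN)) _.
    by split=> [|v|v]; [exact: cst_continuous|rewrite eqxx|rewrite normr0].
  by move=> v; exact: sqrtr_ge0.
have HN t : (forall r, r \in rs -> e <= `|t - r|) -> `|H t| <= C * e * (S + N t).
  move=> far; have tgt := test_function_slice t tg.
  (* The scale [e] passes unchanged to the inner phase: [|Q t|] supplies [|c| * e ^ j], the part of
     [ce] belonging to the outer variable. *)
  have Qt : 1 <= `|Q.[t]| * e ^+ sumn al.
    apply: le_trans ce _; rewrite -lQ exprD mulrA ler_wpM2r ?exprn_ge0 ?(ltW e0)//.
    by apply: Qge => //; exact: ltW.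
  have Ht : `|H t| <= C * e * (S + grad_L1 (fun v => g (slice t v))).
    exact: IH (continuous_slice_fix (t := t) cPhi) tgt (PhiQ t) e0 Qt.
  apply: le_trans Ht _.
  rewrite ler_wpM2l ?mulr_ge0 ?(ltW e0)// lerD2l.
  have [B' tN'] := tame_grad_norm tgt.
  apply: (le_integral_Rn M0 tN' (tame_family_fix t (tame_slice tN))) => v.
  exact: grad_norm_slice.
(* Induction hypothesis off the wells, trivial bound on them. Writing [plateau M S] for [S] keeps
   the first term integrable. *)
pose W t := C * e * (plateau M S t + N t) + S * V * wells rs e t.
have HW t : `|H t| <= W t.
  have b0 : 0 <= plateau M S t by exact: plateau_ge0.
  have CN0 : 0 <= C * e * (plateau M S t + N t).
    by rewrite mulr_ge0 ?addr_ge0 ?mulr_ge0 ?(ltW e0)//.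
  have w0 := wells_ge0 rs e t.
  have SV0 : 0 <= S * V * wells rs e t by rewrite !mulr_ge0.
  have Hb : `|H t| <= plateau M (S * V) t by exact: (norm_integral_slice M0 t tF).
  have [tM|tM] := boolP (t \in `[- M, M]); last first.
    have H0 : plateau M (S * V) t = 0.
      by rewrite /plateau indicE memNset ?mulr0//; exact/negP.
    by rewrite /W (le_trans Hb)// H0 addr_ge0.
  have bE K : plateau M K t = K by rewrite /plateau indicE mem_set ?mulr1.
  have [near|far] := pselect (exists2 r, r \in rs & `|t - r| < e).
    have [r rrs tr] := near.
    rewrite /W (le_trans Hb)// bE.
    apply: (@le_trans _ _ (S * V * wells rs e t)); last by rewrite lerDr.
    rewrite ler_peMr ?mulr_ge0// /wells (perm_big _ (perm_to_rem rrs)) big_cons.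
    rewrite indicE mem_set/=; first by rewrite lerDl; exact: wells_ge0.
    by rewrite in_itv/=; move: tr; rewrite ltr_norml => /andP[? ?];
      apply/andP; split; lra.
  rewrite /W bE (le_trans (HN t _)) ?lerDl// => r rrs.
  by rewrite leNgt; apply/negP => tr; apply: far; exists r.
have [iw Iw] := Rintegral_wells rs (ltW e0).
have iN : mu.-integrable setT (EFin \o N) := integrable_slice M0 tN.
have ib : mu.-integrable setT (EFin \o plateau M S) by exact: integrable_plateau.
have iH : mu.-integrable setT (EFin \o H) := integrable_slice M0 tF.
apply: le_trans (le_normr_Rintegral measurableT iH) _.
apply: (@le_trans _ _ (\int[mu]_t W t)).
  apply: le_Rintegral => //; first exact: integrable_norm iH.
  by apply: integrable_EFinD; apply: integrable_EFinZ => //; exact: integrable_EFinD.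
have -> : \int[mu]_t W t =
    C * e * (S * (2 * M) + grad_L1 g) + S * V * (j%:R * (2 * e)).
  rewrite /W RintegralD//; [|
    by apply: integrable_EFinZ; exact: integrable_EFinD|exact: integrable_EFinZ].
  rewrite RintegralZl//; last exact: integrable_EFinD.
  rewrite RintegralZl// RintegralD// Rintegral_plateau// Iw rsj.
  by congr (_ * (_ + _) + _).
have g0 := grad_L1_ge0 tg.
rewrite -/V -subr_ge0.
have -> : (C * (2 * M + 1) + 2 * j%:R * V) * e * (S + grad_L1 g) -
    (C * e * (S * (2 * M) + grad_L1 g) + S * V * (j%:R * (2 * e))) =
    C * e * S + C * (2 * M) * e * grad_L1 g + 2 * j%:R * V * e * grad_L1 g by ring.
by have ? := ltW e0; rewrite !addr_ge0 ?mulr_ge0.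
Qed.

End oscillatory.

(** * Base case: oscillation in the outermost variable only *)

Lemma derive_derivable_oo_LRcontinuous (R : realType) (F f : R -> R) (a b : R) :
  a <= b -> (forall x : R, a <= x <= b -> is_derive x 1 F (f x)) ->
  derivable_oo_LRcontinuous F a b /\ {in `]a, b[, derive1 F =1 f}.
Proof.
move=> ab dF.
have cF x : a <= x <= b -> {for x, continuous F}.
  move=> /dF[dFx _]; apply: differentiable_continuous.
  exact/derivable1_diffP.
split=> [|x].
  split=> [x||].
  - by rewrite in_itv/= => /andP[/ltW ax /ltW xb]; have [] := dF x; rewrite ?ax.
  - by apply: cvg_at_right_filter; apply: cF; rewrite lexx.
  - by apply: cvg_at_left_filter; apply: cF; rewrite lexx andbT.
rewrite in_itv/= => /andP[/ltW ax /ltW xb].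
by rewrite derive1E; have [] := dF x; rewrite ?ax.
Qed.

(** Integrate by parts against the antiderivative [F] of [cos Q] that vanishes at [a]. Van der
    Corput's estimate bounds [F] uniformly, and the boundary terms vanish because [a] and [b] lie
    outside [[-M, M]]. *)
Lemma oscillatory_line (R : realType) (M e : R) (j : nat) (Q : {poly R})
    (G G' N : R -> R) : 0 <= M -> 0 < e -> size Q = j.+2 ->
  1 <= `|lead_coef Q| * e ^+ j.+1 ->
  (forall t, G t != 0 -> `|t| <= M) ->
  (forall t : R, is_derive t 1 G (G' t)) -> continuous G' ->
  (forall t, `|G' t| <= N t) ->
  (@lebesgue_measure R).-integrable setT (EFin \o N) ->
  `|\int[@lebesgue_measure R]_t (cos Q.[t] * G t)| <=
    2 ^+ (3 * j) * (4 * e) * \int[@lebesgue_measure R]_t N t.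
Proof.
set mu := @lebesgue_measure R.
move=> M0 e0 sQ ce sG dG cG' GN iN.
pose b := M + 1; pose a := - b.
have ab : a < b by rewrite /a /b; lra.
pose f t := cos Q.[t].
have cf : continuous f.
  move=> t; apply: continuous_comp; first exact: continuous_horner.
  exact: continuous_cos.
(* Starting at [a - 1] makes [a] an interior point, so that [F0] has a two-sided derivative
   there. *)
pose F0 x := \int[mu]_(t in `[a - 1, x]) f t.
pose F x := F0 x - F0 a.
have dF x : a <= x <= b -> is_derive x 1 F (f x).
  move=> /andP[ax xb].
  have ifab : mu.-integrable `[a - 1, b + 1] (EFin \o f).
    apply: continuous_compact_integrable; first exact: segment_compact.
    exact: continuous_subspaceT.
  have [||d1 d2] := continuous_FTC1_closed _ ifab _ (cf x); [lra|lra|].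
  have dF0 : is_derive x 1 F0 (f x) by apply: DeriveDef => //; rewrite -derive1E.
  have := is_deriveB dF0 (is_derive_cst (F0 a) x 1).
  by rewrite subr0.
pose K := 2 ^+ (3 * j) * (4 * e).
have K0 : 0 <= K by rewrite /K !mulr_ge0 ?exprn_ge0 ?(ltW e0).
have FK x : a <= x <= b -> `|F x| <= K.
  move=> /andP[ax xb]; have -> : F x = F x - F a by rewrite /F subrr subr0.
  apply: (van_der_corput e0 sQ ce ax) => y /andP[ay yx].
  by apply: dF; rewrite ay (le_trans yx xb).
have [G1 G2] := derive_derivable_oo_LRcontinuous (ltW ab) (fun x _ => dG x).
have [F1 F2] := derive_derivable_oo_LRcontinuous (ltW ab) dF.
have parts := Rintegration_by_parts ab (continuous_subspaceT cG') G1 G2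
  (continuous_subspaceT cf) F1 F2.
have Gb : G b = 0.
  by apply: contraTeq isT => /sG; rewrite /b; have := ler_norm (M + 1); lra.
have Ga : G a = 0.
  apply: contraTeq isT => /sG; rewrite /a /b normrN.
  by have := ler_norm (M + 1); lra.
have -> : \int[mu]_t (cos Q.[t] * G t) = \int[mu]_(t in `[a, b]) (G t * f t).
  rewrite [RHS]Rintegral_mkcond; apply: eq_Rintegral => t _.
  rewrite patchE /f mulrC; case: ifPn => // /negP tab.
  suff -> : G t = 0 by rewrite mul0r.
  apply: contrapT => /eqP/sG; rewrite ler_norml => /andP[? ?].
  apply: tab; rewrite inE/= in_itv/= /a /b; apply/andP; split; lra.
rewrite parts Gb Ga !mul0r subrr sub0r normrN.
have cF : {within `[a, b], continuous F}.
  exact: derivable_oo_LRcontinuous_within F1.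
have iGF : mu.-integrable `[a, b] (EFin \o (fun x => G' x * F x)).
  apply: continuous_compact_integrable; first exact: segment_compact.
  move=> x; apply: (@continuousM _ _ (G' : subspace `[a, b] -> R)); last exact: cF.
  exact: (continuous_subspaceT cG').
have N0 t : 0 <= N t by exact: le_trans (normr_ge0 _) (GN t).
have iNab : mu.-integrable `[a, b] (EFin \o N).
  by apply: integrableS iN.
apply: le_trans (le_normr_Rintegral _ iGF) _ => //.
apply: (@le_trans _ _ (\int[mu]_(t in `[a, b]) (K * N t))).
  apply: le_Rintegral => //; first exact: integrable_norm iGF.
    by apply: integrableS (integrable_EFinZ K iN).
  move=> t /=; rewrite in_itv/= => tab; rewrite normrM mulrC.
  by rewrite ler_pM// FK.
rewrite RintegralZl// ler_wpM2l// Rintegral_mkcond.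
apply: le_Rintegral => //.
  by rewrite -restrict_EFin; apply/integrable_restrict => //=; rewrite setTI.
by move=> t _; rewrite patchE; case: ifP.
Qed.

(** [C] is chosen before [Phi] and [c], because the induction applies the bound to slices whose
    coefficients vary with [t]. The scale [e] stands for [|c|^(-1/|al|)] without fractional
    powers. *)
Lemma oscillatory_bound (R : realType) (M : R) (n : nat) (al : seq nat) :
  0 <= M -> size al = n -> (0 < sumn al)%N -> exists2 C, 0 <= C &
  forall (Phi g : 'rV[R]_n -> R) c S e,
    continuous Phi -> test_function M S g ->
    phase al c Phi -> 0 < e -> 1 <= `|c| * e ^+ sumn al ->
    `|integral_Rn (fun v => cos (Phi v) * g v)| <= C * e * (S + grad_L1 g).
Proof.
move=> M0 <-{n}; elim: al => [//|j al IH] al0.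
have [al00|al_gt0] := posnP (sumn al); last first.
  have [C C0 HC] := IH al_gt0.
  exists (C * (2 * M + 1) + 2 * j%:R * (2 * M) ^+ size al).
    by rewrite addr_ge0 ?mulr_ge0 ?addr_ge0 ?exprn_ge0 ?mulr_ge0.
  exact: oscillatory_step.
case: j al0 => [|j] al0; first by rewrite /= al00 in al0.
exists (2 ^+ (3 * j) * 4) => [|Phi g c S e cPhi tg [Q [/= sQ Qc PhiQ]] e0 ce].
  by rewrite mulr_ge0 ?exprn_ge0.
rewrite /= al00 addn0 in ce.
have c0 : c != 0 by apply: contraTneq ce => ->; rewrite normr0 mul0r lt_geF.
have {}sQ : size Q = j.+2 by apply: size_coef_neq0; rewrite ?Qc.
have lQ : lead_coef Q = c by rewrite lead_coefE sQ.
have [tg0 dg [B tpg]] := tg.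
have S0 := tame_bound_ge0 tg0.
pose G t := integral_Rn (fun v => g (slice t v)).
pose G' t := integral_Rn (fun v => partial ord0 g (slice t v)).
pose N t := integral_Rn (fun v => grad_norm g (slice t v)).
have [B' tN] := tame_grad_norm tg.
have dG (t : R) : is_derive t 1 G (G' t).
  apply: (is_derive_integral_Rn M0 (tame_slice tg0) (tame_slice (tpg ord0))).
  by move=> r v; apply: is_derive_slice; exact: dg.
have GN t : `|G' t| <= N t.
  apply: (norm_integral_Rn M0 (tame_family_fix t (tame_slice (tpg ord0)))
    (tame_family_fix t (tame_slice tN))) => v.
  exact: partial_le_grad_norm.
have iN : (@lebesgue_measure R).-integrable setT (EFin \o N) :=
  integrable_slice M0 tN.
rewrite -lQ in ce.
have := oscillatory_line M0 e0 sQ ce (tame_slice_support tg0) dG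
  (continuous_integral_slice M0 (tpg ord0)) GN iN.
(* The phase is constant in the inner variables, so the cosine leaves the inner integral. *)
have -> : \int[@lebesgue_measure R]_t (cos Q.[t] * G t) =
    integral_Rn (fun v => cos (Phi v) * g v).
  apply: eq_Rintegral => t _.
  rewrite -(integral_RnZ M0 _ (tame_family_fix t (tame_slice tg0))).
  congr integral_Rn; apply/funext => v; congr (cos _ * _).
  by rewrite (phase_const al00 (PhiQ t)).
move=> /le_trans; apply.
rewrite [X in _ * X <= _](_ : _ = grad_L1 g)// mulrA ler_wpM2l ?lerDr//.
by rewrite !mulr_ge0 ?exprn_ge0 ?(ltW e0).
Qed.

(** * The lexicographically leading monomial *)

(** The number with base-[N] digits [al], least significant digit first. *)
Definition weight (N : nat) (al : seq nat) : nat :=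
  foldr (fun i w => i + N * w)%N 0%N al.

Lemma weight_gt0 N al : (0 < N)%N -> (0 < weight N al)%N = (0 < sumn al)%N.
Proof.
by move=> N0; elim: al => //= i al IH; rewrite !addn_gt0 muln_gt0 N0 IH.
Qed.

(* Comparing weights in base [N] amounts to comparing exponents
   lexicographically, the last variable being the most significant. *)
Lemma phase_sum (R : realType) (n N : nat) (s : seq (R * seq nat)) (al : seq nat) :
  size al = n -> all (fun i => i < N)%N al ->
  (forall p, p \in s -> size p.2 = n /\ (weight N p.2 <= weight N al)%N) ->
  phase al (\sum_(p <- s | p.2 == al) p.1)
    (fun v : 'rV[R]_n => \sum_(p <- s) p.1 * \prod_(i < n) v 0 i ^+ nth 0%N p.2 i).
Proof.
elim: n s al => [|n IH] s [|j al]//=.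
  move=> _ _ sP v; rewrite big_seq [RHS]big_seq_cond.
  apply: eq_big => [p|p _]; last by rewrite big_ord0 mulr1.
  by case: (boolP (p \in s)) => //= /sP[/size0nil -> _].
move=> [aln] /andP[jN alN] sP.
have sE p : p \in s -> p.2 = head 0%N p.2 :: behead p.2.
  by move=> /sP[+ _]; case: (p.2).
have sw p : p \in s -> (weight N (behead p.2) <= weight N al)%N /\
    (behead p.2 == al -> head 0 p.2 <= j)%N.
  move=> ps; have [_] := sP p ps; rewrite (sE p ps) /= => pw.
  split=> [|/eqP pal]; last by move: pw; rewrite pal leq_add2r.
  rewrite leqNgt; apply/negP => wlt; move: pw; rewrite leqNgt => /negP; apply.
  (* A digit [j < N] cannot make up for a tail whose weight is smaller by at least one. *)
  apply: (@leq_trans (N * (weight N al).+1)).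
    by rewrite mulnS ltn_add2r.
  by apply: leq_trans (leq_addl _ _); rewrite leq_mul2l wlt orbT.
exists (\sum_(p <- s | behead p.2 == al) p.1 *: 'X^(head 0%N p.2)); split.
- rewrite big_seq_cond; apply: leq_trans (size_sum _ _ _) _.
  apply/bigmax_leqP_seq => p _ /andP[ps pal].
  apply: leq_trans (size_scale_leq _ _) _; rewrite size_polyXn ltnS.
  by have [_] := sw p ps; exact.
- rewrite coef_sum [LHS]big_mkcond [RHS]big_mkcond [LHS]big_seq [RHS]big_seq.
  apply: eq_bigr => p ps.
  rewrite [in RHS](sE p ps) eqseq_cons coefZ coefXn eq_sym andbC.
  by case: eqP => //= _; rewrite (eq_sym j); case: eqP => _; rewrite ?mulr1 ?mulr0.
- move=> t.
  (* Fixing the first variable at [t] absorbs its power into the coefficient. Several entries may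
     then share an exponent, which is why the leading coefficient is a sum over a list. *)
  pose st := [seq (p.1 * t ^+ head 0%N p.2, behead p.2) | p <- s].
  have -> : (\sum_(p <- s | behead p.2 == al) p.1 *: 'X^(head 0%N p.2)).[t] =
      \sum_(q <- st | q.2 == al) q.1.
    by rewrite horner_sum big_map; apply: eq_bigr => p _; rewrite hornerZ hornerXn.
  have -> : (fun v : 'rV[R]_n => \sum_(p <- s) p.1 *
        \prod_(i < n.+1) slice t v 0 i ^+ nth 0%N p.2 i) =
      (fun v => \sum_(q <- st) q.1 * \prod_(i < n) v 0 i ^+ nth 0%N q.2 i).
    apply/funext => v; rewrite big_map big_seq [RHS]big_seq; apply: eq_bigr => p ps.
    rewrite big_ord_recl slice0 mulrA /= (sE p ps) /=; congr (_ * _).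
    by apply: eq_bigr => i _; rewrite sliceS.
  apply: IH => // q /mapP[p ps ->] /=; have [ww _] := sw p ps; split=> //.
  by rewrite size_behead; have [-> _] := sP p ps.
Qed.

Lemma seq_argmax (T : eqType) (w : T -> nat) (s : seq T) x : x \in s ->
  exists2 y, y \in s & forall z, z \in s -> (w z <= w y)%N.
Proof.
elim: s x => [//|a s IH] x _; case: s IH => [|b s] IH.
  by exists a => [|z]; rewrite mem_seq1 => // /eqP ->.
have [y ys wy] := IH b (mem_head _ _).
have [ay|ya] := leqP (w a) (w y).
  by exists y => [|z]; rewrite in_cons ?ys ?orbT// => /predU1P[->|/wy].
exists a => [|z]; first exact: mem_head.
by rewrite in_cons => /predU1P[->//|/wy/leq_trans]; apply; exact: ltnW.
Qed.

#[local] Canonical mpoly.mpoly_multinom__canonical__eqtype_Equality.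

(** Take the monomial of largest weight in base [pdeg f + 1], for which all exponents are digits.
    Some monomial has positive degree, hence positive weight, so the one chosen is not constant. *)
Lemma peval_phase (R : realType) (n : nat) (f : mpoly.mpoly n R) :
  (0 < pdeg f)%N -> exists al c,
    [/\ size al = n, (0 < sumn al <= pdeg f)%N, c != 0 & phase al c (peval f)].
Proof.
move=> f0.
pose N := (pdeg f).+1.
pose ex (m : mpoly.multinom n) : seq nat := mpoly.multinom_val m.
have exi m (i : 'I_n) : nth 0%N (ex m) i = mpoly.fun_of_multinom m i.
  by rewrite /mpoly.fun_of_multinom (tnth_nth 0%N).
have sex m : size (ex m) = n by rewrite /ex size_tuple.
have exsum m : sumn (ex m) = mpoly.mdeg m.
  rewrite mpoly.mdegE sumnE (big_nth 0%N) sex big_mkord.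
  by apply: eq_bigr => i _; rewrite exi.
have degf m : m \in mpoly.msupp f -> (mpoly.mdeg m <= pdeg f)%N.
  by move=> mf; rewrite /pdeg; apply: leq_bigmax_seq.
have [m1 m1f m1_gt0] : exists2 m, m \in mpoly.msupp f & (0 < mpoly.mdeg m)%N.
  apply: contrapT => h; move: f0; rewrite /pdeg big_seq big1 // => m mf.
  by apply/eqP; rewrite -leqn0 leqNgt; apply/negP => m0; apply: h; exists m.
have [m mf mmax] := seq_argmax (fun m => weight N (ex m)) m1f.
exists (ex m), (mpoly.mcoeff m f); split.
- exact: sex.
- rewrite exsum degf// andbT -exsum -(@weight_gt0 N)//.
  apply: leq_trans (mmax _ m1f).
  by rewrite weight_gt0// exsum.
- by rewrite -mpoly.mcoeff_msupp.
pose s := [seq (mpoly.mcoeff m f, ex m) | m <- mpoly.msupp f].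
have -> : mpoly.mcoeff m f = \sum_(p <- s | p.2 == ex m) p.1.
  rewrite big_map big_mkcond (bigD1_seq m) ?mpoly.msupp_uniq//=.
  rewrite eqxx big1 ?addr0// => m' m'm; case: eqP => // exm'; case/eqP: m'm.
  by have /= := val_inj exm'; case: (m) (m') => x [y] /= ->.
have -> : peval f = (fun v : 'rV[R]_n =>
    \sum_(p <- s) p.1 * \prod_(i < n) v 0 i ^+ nth 0%N p.2 i).
  apply/funext => v; rewrite /peval mpoly.mevalE [RHS]big_map.
  apply: eq_bigr => m' _.
  by congr (_ * _); apply: eq_bigr => i _; rewrite exi.
apply: (@phase_sum _ _ N) => //.
  apply/allP => i im; rewrite ltnS; apply: leq_trans (degf m mf); rewrite -exsum.
  by rewrite sumnE (big_rem i)//= leq_addr.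
by move=> p /mapP[m' m'f ->] /=; split; [exact: sex|exact: mmax].
Qed.

(** * Continuity of polynomials, and passage from [C1] to test functions *)

Lemma continuous_peval (R : realType) (n : nat) (f : mpoly.mpoly n R) :
  continuous (peval f).
Proof.
have -> : peval f = (fun v => \sum_(m <- mpoly.msupp f)
    mpoly.mcoeff m f * \prod_i v 0 i ^+ mpoly.fun_of_multinom m i).
  by apply/funext => v; rewrite /peval mpoly.mevalE.
apply: (@continuous_big R _ +%R 0 predT _ 'rV[R]_n) => [|m _ v].
  exact: add_continuous.
apply: continuousM; first exact: cst_continuous.
apply: (@continuous_big R _ *%R 1 predT _ 'rV[R]_n) => [|i _ w].
  exact: mul_continuous.
exact: (@continuous_comp _ _ _ (fun v : 'rV[R]_n => v 0 i) (fun x => x ^+ _) w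
  (@coord_continuous _ _ _ _ _ w) (@exprn_continuous _ _ _)).
Qed.

Lemma le_mx_norm_coord (R : realType) (n : nat) (v : 'rV[R]_n) i : `|v 0 i| <= `|v|.
Proof. by rewrite [leRHS]/Num.norm /= mx_normrE; apply: (le_bigmax _ _ (0, i)). Qed.

Lemma tame_exists (R : realType) (n : nat) (M : R) (F : 'rV[R]_n -> R) :
  continuous F -> (forall v, F v != 0 -> in_box M v) -> exists B, tame M B F.
Proof.
move=> cF sF.
have cbox : compact [set v : 'rV[R]_n | forall i, v ord0 i \in `[- M, M]].
  by apply: (@rV_compact _ _ (fun=> `[- M, M]%classic)) => _; exact: segment_compact.
have := compact_bounded (continuous_compact (continuous_subspaceT cF) cbox).
move=> [B [_ FB]]; exists (`|B| + 1); split=> // v.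
have [->|Fv] := eqVneq (F v) 0; first by rewrite normr0 addr_ge0.
apply: (FB (`|B| + 1)); first by rewrite (le_lt_trans (ler_norm B))// ltrDl.
by exists v => // i /=; rewrite in_itv/= -ler_norml; exact: sF.
Qed.

Lemma partial_support (R : realType) (n : nat) (g : 'rV[R]_n -> R) i v :
  partial i g v != 0 -> support_fn g v.
Proof.
apply: contra_neqP => gv; rewrite /partial.
have near0 : \forall w \near v, g w = 0.
  move: gv => /existsNP[U /not_implyP[Uv Ug]].
  apply: filterS Uv => w Uw; apply: contrapT => /eqP gw; apply: Ug.
  by exists w.
by rewrite (near_eq_derive (g := cst 0)) ?derive_cst.
Qed.

Lemma C1_test_function (R : realType) (n : nat) (M : R) (g : 'rV[R]_n -> R) :
  C1 g -> (forall v, support_fn g v -> in_box M v) ->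
  test_function M (sup_norm g) g.
Proof.
move=> [dg cg] sg.
have gsupp v : g v != 0 -> support_fn g v.
  by move=> gv; apply: subset_closure.
have cont_g : continuous g by move=> v; exact: differentiable_continuous.
have [B0 [_ _ gB]] : exists B, tame M B g.
  by apply: tame_exists => // v /gsupp/sg.
split.
- split=> // [v /gsupp/sg//|v].
  apply: ub_le_sup; last by exists v.
  by exists B0 => _ [w _ <-].
- by move=> i v; exact: diff_derivable.
have /choice[B tB] : forall i, exists B, tame M B (partial i g).
  by move=> i; apply: tame_exists => // v /partial_support/sg.
exists (\sum_i `|B i|) => i; have [cp sp bp] := tB i; split=> // v.
rewrite (le_trans (bp v))// (le_trans (ler_norm _))// (bigD1 i)//= lerDl.
by apply: sumr_ge0.
Qed.

(** * Choice of the scale and passage to the modulus *)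

Lemma sqrt_sum_le (R : rcfType) (x y K : R) : `|x| <= K -> `|y| <= K ->
  Num.sqrt (x ^+ 2 + y ^+ 2) <= 2 * K.
Proof.
move=> xK yK; have K0 : 0 <= K := le_trans (normr_ge0 x) xK.
rewrite -[leRHS]ger0_norm ?mulr_ge0// -sqrtr_sqr ler_wsqrtr//.
move: xK yK; rewrite !ler_norml => /andP[? ?] /andP[? ?]; nra.
Qed.

Theorem theorem2 (R : realType) (n : nat) (f : mpoly.mpoly n R) (d : nat)
    (hdeg : pdeg f = d) (hd : (1 <= d)%N)
    (A : set 'rV[R]_n) (hAc : compact A) (hAs : semialgebraic A) :
  exists C : R, 0 < C /\
    forall g : 'rV[R]_n -> R,
      C1 g -> compact (support_fn g) -> support_fn g `<=` A ->
      forall lam : R, 0 < lam ->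
        osc_integral_abs f A g lam
          <= C * powR lam (- (d%:R)^-1) * (sup_norm g + grad_L1 g).
Proof.
have [M M0 AM] : exists2 M : R, 0 <= M & forall v, A v -> in_box M v.
  have [B [_ AB]] := compact_bounded hAc.
  exists (`|B| + 1) => [|v Av i]; first by rewrite addr_ge0.
  apply: le_trans (le_mx_norm_coord v i) _; apply: AB => //.
  by rewrite (le_lt_trans (ler_norm B))// ltrDl.
have f0 : (0 < pdeg f)%N by rewrite hdeg.
have [al [c [aln /andP[al0 ald] c0 Phif]]] := peval_phase f0.
rewrite hdeg in ald.
have [C0 C0_ge0 HC] := oscillatory_bound M0 aln al0.
(* [K] absorbs the coefficient [c], so that [K * y] with [y = lam^(-1/d)] is an admissible scale for
   the phase [lam * f] when [lam >= 1]. *)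
pose K := 1 + `|c|^-1.
have K1 : 1 <= K by rewrite lerDl invr_ge0.
have cK : 1 <= `|c| * K ^+ sumn al.
  apply: (@le_trans _ _ (`|c| * K)).
    by rewrite mulrDr mulr1 mulfV ?normr_eq0// lerDr.
  by rewrite ler_wpM2l// -[leLHS]expr1 ler_weXn2l.
(* The terms serve, in order, the case [lam >= 1], the case [lam < 1], and the positivity of the
   constant. *)
pose Kf := C0 * K + (2 * M) ^+ n + 1.
have V0 : 0 <= (2 * M) ^+ n by rewrite exprn_ge0// mulr_ge0.
have C0K : 0 <= C0 * K by rewrite mulr_ge0// (le_trans ler01).
exists (2 * Kf); split.
  by rewrite /Kf mulr_gt0// ltr_pwDr// addr_ge0.
move=> g gC1 _ gA lam lam0.
have tg : test_function M (sup_norm g) g.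
  by apply: C1_test_function => // v /gA/AM.
have [tg0 _ _] := tg.
have S0 := tame_bound_ge0 tg0.
have G0 := grad_L1_ge0 M0 tg.
pose y := lam `^ (- d%:R^-1).
have y0 : 0 < y by exact: powR_gt0.
have yd : y ^+ d = lam^-1.
  rewrite -powR_mulrn ?powR_ge0// -powRrM mulNr mulVf ?powR_inv1 ?ltW//.
  by rewrite pnatr_eq0 -lt0n.
(* The shift [mu] treats both parts at once: 0 gives the cosine and [- pi / 2] the sine. *)
have bound mu : `|integral_Rn (fun v => cos (lam * peval f v + mu) * g v)| <=
    Kf * y * (sup_norm g + grad_L1 g).
  have cPhi : continuous (fun v => lam * peval f v + mu).
    have -> : (fun v => lam * peval f v + mu) =
        horner (lam *: 'X + mu%:P) \o peval f.
      by apply/funext => v; rewrite /= !hornerE.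
    move=> v; apply: continuous_comp; first exact: continuous_peval.
    exact: continuous_horner.
  have SG0 : 0 <= sup_norm g + grad_L1 g by rewrite addr_ge0.
  have [lam1|lam1] := leP 1 lam.
    apply: (@le_trans _ _ (C0 * (K * y) * (sup_norm g + grad_L1 g))).
      apply: (HC _ _ _ _ _ cPhi tg (phase_affine lam mu aln Phif)).
        by rewrite mulr_gt0// (lt_le_trans ltr01).
      rewrite (negPf (lt0n_neq0 al0)) addr0 normrM (gtr0_norm lam0) exprMn.
      have y1 : y <= 1 by rewrite -(powRr0 lam) ler_powR// oppr_le0 invr_ge0.
      (* Since [y <= 1] and [sumn al <= d], the power of [y] is at least [y ^ d = 1 / lam]. *)
      have lamy : 1 <= lam * y ^+ sumn al.
        rewrite -(@mulfV _ lam) ?gt_eqF// ler_pM2l// -yd.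
        by apply: ler_wiXn2l => //; exact: ltW.
      have -> : lam * `|c| * (K ^+ sumn al * y ^+ sumn al) =
          (`|c| * K ^+ sumn al) * (lam * y ^+ sumn al) by ring.
      exact: mulr_ege1.
    rewrite mulrA /Kf ler_wpM2r// ler_wpM2r ?(ltW y0)// -addrA lerDl.
    by rewrite addr_ge0.
  have y1 : 1 <= y.
    have lam01 : 0 < lam <= 1 by rewrite lam0 ltW.
    by rewrite -(powRr0 lam) ger_powR// oppr_le0 invr_ge0.
  apply: le_trans (norm_integral_le M0 (tame_cos cPhi tg0)) _.
  apply: (@le_trans _ _ (Kf * sup_norm g)).
    by rewrite mulrC ler_wpM2r// /Kf -addrA addrCA lerDl addr_ge0.
  have Kf0 : 0 <= Kf by rewrite /Kf !addr_ge0.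
  rewrite -mulrA ler_wpM2l// (@le_trans _ _ (sup_norm g + grad_L1 g)) ?lerDl//.
  by rewrite ler_peMl.
have restrE (h : 'rV[R]_n -> R) :
    restr A (fun x => h x * g x) = (fun x => h x * g x).
  apply/funext => x; rewrite /restr; case: asboolP => // Ax.
  suff -> : g x = 0 by rewrite mulr0.
  apply: contrapT => /eqP gx; apply: Ax; apply: gA.
  exact: subset_closure.
rewrite /osc_integral_abs !restrE.
have cosE : (fun x => cos (lam * peval f x) * g x) =
    (fun x => cos (lam * peval f x + 0) * g x).
  by apply/funext => x; rewrite addr0.
have sinE : (fun x => sin (lam * peval f x) * g x) =
    (fun x => cos (lam * peval f x - pi / 2) * g x).
  by apply/funext => x; rewrite cosBpihalf.
rewrite cosE sinE; apply: le_trans (sqrt_sum_le (bound 0) (bound (- (pi / 2)))) _.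
by rewrite !mulrA.
Qed.
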